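(* Let $\mathfrak{g}\in\mathbb{H}$ and $\mathfrak{h}\in\mathbb{H}_d$ be such that $\mathfrak{h}(x)\lesssim x^\alpha$ (for small $x>0$) for some $0<\alpha<1$, and let $E$ be an $F_{\mathfrak{h}\mathfrak{g}}$-set. Let $h\in\mathbb{H}$ with $h\prec\mathfrak{h}\sqrt{\mathfrak{g}}$. If $$\sum_k\left(\frac{\mathfrak{h}(2^{-k})\sqrt{\mathfrak{g}(2^{-k})}}{h(2^{-k})}\right)^{\frac{2\alpha}{2\alpha+1}}<\infty,$$ then $\mathcal{H}^h(E)>0$.
   Context: $\mathbb{H}$ is the class of non-decreasing, right continuous functions $h:[0,\infty)\to[0,\infty)$ with $h(0)=0$; $\mathbb{H}_d=\{h\in\mathbb{H}: h(2x)\le Ch(x)\text{ for all }x\text{ and some }C>0\}$. For $g,h\in\mathbb{H}$, $g\prec h$ means $\lim_{x\to0^+}h(x)/g(x)=0$. $A\lesssim B$ means $A\le cB$ for a constant $c>0$. For $h\in\mathbb{H}$, $F\subseteq\mathbb{R}^n$, $\delta>0$: $\mathcal{H}^h_\delta(F)=\inf\{\sum_i h(\mathrm{diam}(F_i)): F\subseteq\bigcup_i F_i,\ \mathrm{diam}(F_i)<\delta\}$ and $\mathcal{H}^h(F)=\sup_{\delta>0}\mathcal{H}^h_\delta(F)$. $\mathbb{S}$ is the unit circle. Given $\mathfrak{h},\mathfrak{g}\in\mathbb{H}$, a set $E\subseteq\mathbb{R}^2$ is an $F_{\mathfrak{h}\mathfrak{g}}$-set if there is $L\subseteq\mathbb{S}$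 with $\mathcal{H}^{\mathfrak{g}}(L)>0$ and a number $\delta_E>0$ such that for each $e\in L$ there is a line segment $\ell_e$ in direction $e$ with $\mathcal{H}^{\mathfrak{h}}_\delta(\ell_e\cap E)>1$ for all $0<\delta<\delta_E$. *)

(* Defs.v *)
From Stdlib Require Import Reals.
Open Scope R_scope.

Definition pt := (R * R)%type.
Definition set2 := pt -> Prop.

Definition dist2 (p q : pt) : R :=
  sqrt ((fst p - fst q) ^ 2 + (snd p - snd q) ^ 2).

Definition is_diam (A : set2) (d : R) : Prop :=
  ((forall p, ~ A p) /\ d = 0) \/
  is_lub (fun r => exists p q, A p /\ A q /\ r = dist2 p q) d.

(* For a nonnegative series a: "sum_i a i >= c" in [0, +oo]. *)
Definition series_ge (a : nat -> R) (c : R) : Prop :=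
  forall c', c' < c -> exists N, c' < sum_f_R0 a N.

Definition Hcontent_ge (h : R -> R) (delta : R) (F : set2) (c : R) : Prop :=
  forall (U : nat -> set2) (d : nat -> R),
    (forall i, is_diam (U i) (d i) /\ d i < delta) ->
    (forall p, F p -> exists i, U i p) ->
    series_ge (fun i => h (d i)) c.

(* "H^h_delta(F) > c"  (the infimum, possibly +oo, exceeds c). *)
Definition Hcontent_gt (h : R -> R) (delta : R) (F : set2) (c : R) : Prop :=
  exists c', c < c' /\ Hcontent_ge h delta F c'.

(* "H^h(F) > 0", with H^h = sup_{delta>0} H^h_delta. *)
Definition Hmeasure_pos (h : R -> R) (F : set2) : Prop :=
  exists delta, 0 < delta /\ Hcontent_gt h delta F 0.

(* The class H (functions on [0,oo); values at negative arguments are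
   irrelevant). *)
Definition classH (h : R -> R) : Prop :=
  h 0 = 0 /\
  (forall x, 0 <= x -> 0 <= h x) /\
  (forall x y, 0 <= x -> x <= y -> h x <= h y) /\
  (forall x, 0 <= x -> forall eps, 0 < eps ->
     exists eta, 0 < eta /\ forall y, x <= y < x + eta -> Rabs (h y - h x) < eps).

Definition classHd (h : R -> R) : Prop :=
  classH h /\ exists C, 0 < C /\ forall x, 0 <= x -> h (2 * x) <= C * h x.

(* g ≺ f : lim_{x->0+} f x / g x = 0 (quotient defined near 0+). *)
Definition prec (g f : R -> R) : Prop :=
  (exists d0, 0 < d0 /\ forall x, 0 < x < d0 -> g x <> 0) /\
  (forall eps, 0 < eps -> exists d, 0 < d /\
     forall x, 0 < x < d -> Rabs (f x / g x) < eps).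

Definition circle (e : pt) : Prop := fst e ^ 2 + snd e ^ 2 = 1.

Definition segment_dir (e : pt) (S : set2) : Prop :=
  exists (a : pt) (l : R), 0 <= l /\
    forall p, S p <-> exists t, 0 <= t <= l /\
       p = (fst a + t * fst e, snd a + t * snd e).

Definition inter (A B : set2) : set2 := fun p => A p /\ B p.

Definition F_set (hh gg : R -> R) (E : set2) : Prop :=
  exists L : set2,
    (forall e, L e -> circle e) /\ Hmeasure_pos gg L /\
    exists dE, 0 < dE /\
      forall e, L e -> exists S, segment_dir e S /\
        forall delta, 0 < delta < dE -> Hcontent_gt hh delta (inter S E) 1.

(* x^y for x >= 0 (with 0^y = 0 for y > 0). *)
Definition rpow (x y : R) : R := if Rle_dec x 0 then 0 else Rpower x y.

(* Main.v *)
Require Import Defs.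
From Stdlib Require Import Reals Lra Lia Classical ClassicalEpsilon
  IndefiniteDescription Arith Cantor.
Open Scope R_scope.

(** Cover [E] by sets [U i] and sort them into dyadic classes, diameters in [[r, 2r)]
    for [r = 2^-k].  Fix summable weights [a k] with sum at most [1].  For each direction
    [e] in [L] some class must carry content at least [a k] of the segment in direction
    [e]; call [e] rich at scale [k].  As [hh(x) <= c x^alpha], an interval of length
    about [eta = a^(1/alpha)] carries little content, so cutting it out leaves two
    pieces of the segment, [eta] apart, each met by at least about [a / hh(r)] sets of
    the class.  Two sets of diameter [2r] at distance [eta] determine a direction up to
    [r / eta]; counting triples (direction, set, set), the rich directions at scale [k]
    are covered by at most about [M^2 hh(r)^2 / (a^2 eta)] arcs of length [r], where [M]
    is the size of the class.  With [a] proportional to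
    [(hh sqrt gg / h)(r)^(2 alpha / (2 alpha + 1))] the [gg]-cost of these arcs is
    bounded by a multiple of [(M h(r))^2].  Summing over [k], the content of [L] is
    bounded by a multiple of the square of the sum of the [h (diam (U i))]. *)

(** * Finite sums and counting of indices *)

Fixpoint sumn (f : nat -> R) (n : nat) : R :=
  match n with O => 0 | S m => sumn f m + f m end.

Definition ind (P : Prop) : R := if excluded_middle_informative P then 1 else 0.

Definition count (P : nat -> Prop) (n : nat) : R := sumn (fun i => ind (P i)) n.

Lemma sum_f_R0_sumn (f : nat -> R) (n : nat) : sum_f_R0 f n = sumn f (S n).
Proof. induction n as [|n IH]; simpl in *; [|rewrite IH]; lra. Qed.

Lemma sumn_le (f g : nat -> R) (n : nat) :
  (forall i, (i < n)%nat -> f i <= g i) -> sumn f n <= sumn g n.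
Proof.
  induction n as [|n IH]; intros H; simpl; [lra|].
  apply Rplus_le_compat; [apply IH; intros; apply H; lia | apply H; lia].
Qed.

Lemma sumn_ext (f g : nat -> R) (n : nat) :
  (forall i, (i < n)%nat -> f i = g i) -> sumn f n = sumn g n.
Proof. intros H; apply Rle_antisym; apply sumn_le; intros i Hi; rewrite (H i Hi); lra. Qed.

Lemma sumn_scal (c : R) (f : nat -> R) (n : nat) :
  sumn (fun i => c * f i) n = c * sumn f n.
Proof. induction n as [|n IH]; simpl; [|rewrite IH]; lra. Qed.

Lemma sumn_plus (f g : nat -> R) (n : nat) :
  sumn (fun i => f i + g i) n = sumn f n + sumn g n.
Proof. induction n as [|n IH]; simpl; [|rewrite IH]; lra. Qed.

Lemma sumn_zero (n : nat) : sumn (fun _ => 0) n = 0.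
Proof. induction n as [|n IH]; simpl; lra. Qed.

Lemma sumn_nonneg (f : nat -> R) (n : nat) : (forall i, 0 <= f i) -> 0 <= sumn f n.
Proof. intros H; rewrite <- (sumn_zero n); apply sumn_le; auto. Qed.

Lemma sumn_switch (f : nat -> nat -> R) (m n : nat) :
  sumn (fun i => sumn (f i) n) m = sumn (fun j => sumn (fun i => f i j) m) n.
Proof.
  induction m as [|m IH]; simpl; [now rewrite sumn_zero|].
  now rewrite IH, sumn_plus.
Qed.

Lemma sumn_add (f : nat -> R) (m n : nat) :
  sumn f (m + n) = sumn f m + sumn (fun i => f (m + i)%nat) n.
Proof.
  induction n as [|n IH]; [rewrite Nat.add_0_r; simpl; lra|].
  rewrite Nat.add_succ_r; simpl; rewrite IH; lra.
Qed.

Lemma sumn_mono (f : nat -> R) (m n : nat) :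
  (forall i, 0 <= f i) -> (m <= n)%nat -> sumn f m <= sumn f n.
Proof.
  intros H Hmn; replace n with (m + (n - m))%nat by lia; rewrite sumn_add.
  pose proof (sumn_nonneg (fun i => f (m + i)%nat) (n - m) (fun i => H _)); lra.
Qed.

Lemma sumn_sqr_le (f : nat -> R) (n : nat) :
  (forall i, 0 <= f i) -> sumn (fun i => f i ^ 2) n <= sumn f n ^ 2.
Proof.
  intros H; induction n as [|n IH]; cbn [sumn]; [lra|].
  pose proof (sumn_nonneg f n H); pose proof (H n); nra.
Qed.

Lemma sumn_mul (f g : nat -> R) (m n : nat) :
  sumn f m * sumn g n = sumn (fun i => sumn (fun j => f i * g j) n) m.
Proof.
  rewrite Rmult_comm, <- sumn_scal; apply sumn_ext; intros i _.
  now rewrite sumn_scal, Rmult_comm.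
Qed.

Lemma ind_true (P : Prop) : P -> ind P = 1.
Proof. unfold ind; destruct (excluded_middle_informative P); tauto. Qed.

Lemma ind_false (P : Prop) : ~ P -> ind P = 0.
Proof. unfold ind; destruct (excluded_middle_informative P); tauto. Qed.

Lemma ind_bounds (P : Prop) : 0 <= ind P <= 1.
Proof. unfold ind; destruct (excluded_middle_informative P); lra. Qed.

Lemma ind_le (P Q : Prop) : (P -> Q) -> ind P <= ind Q.
Proof.
  intros H; destruct (classic P) as [HP|HP].
  - rewrite (ind_true P), (ind_true Q); auto; lra.
  - rewrite (ind_false P HP); apply ind_bounds.
Qed.

Lemma count_nonneg (P : nat -> Prop) (n : nat) : 0 <= count P n.
Proof. apply sumn_nonneg; intros; apply ind_bounds. Qed.

Lemma count_le (P Q : nat -> Prop) (n : nat) :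
  (forall i, P i -> Q i) -> count P n <= count Q n.
Proof. intros H; apply sumn_le; intros; apply ind_le; auto. Qed.

Lemma count_empty (P : nat -> Prop) (n : nat) : (forall i, ~ P i) -> count P n = 0.
Proof.
  intros H; unfold count; rewrite <- (sumn_zero n); apply sumn_ext.
  intros; apply ind_false; auto.
Qed.

Lemma count_support (P : nat -> Prop) (N M : nat) :
  (forall i, P i -> (i < N)%nat) -> count P M <= count P N.
Proof.
  intros H; destruct (Nat.le_gt_cases M N) as [HMN|HMN].
  - apply sumn_mono; [intros; apply ind_bounds|assumption].
  - unfold count; replace M with (N + (M - N))%nat by lia; rewrite sumn_add.
    assert (E : sumn (fun i => ind (P (N + i)%nat)) (M - N) = 0).
    { apply (count_empty (fun i => P (N + i)%nat)).
      intros i Hi; specialize (H _ Hi); lia. }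
    lra.
Qed.

Lemma count_from (x : R) (n : nat) :
  count (fun m => x <= INR m) n <= Rmax 0 (INR n - x).
Proof.
  unfold count; induction n as [|n IH]; [apply Rmax_l|].
  rewrite S_INR; simpl sumn.
  destruct (Rle_dec x (INR n)) as [Hx|Hx].
  - rewrite ind_true by assumption.
    rewrite Rmax_right in IH by lra; rewrite Rmax_right by lra; lra.
  - rewrite ind_false by assumption.
    rewrite Rmax_left in IH by lra.
    pose proof (Rmax_l 0 (INR n + 1 - x)); lra.
Qed.

(** The last counted index [n] forces all the others into [[n - w, n]], which holds at most [w + 1]
    integers. *)
Lemma count_window (P : nat -> Prop) (w : R) (n : nat) :
  0 <= w -> (forall i j, P i -> P j -> INR j - INR i <= w) -> count P n <= w + 1.
Proof.
  intros Hw H; induction n as [|n IH]; [unfold count; simpl; lra|].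
  destruct (classic (P n)) as [Hn|Hn].
  - apply Rle_trans with (count (fun m => INR n - w <= INR m) (S n)).
    + apply count_le; intros i Hi; specialize (H i n Hi Hn); lra.
    + eapply Rle_trans; [apply count_from|]; rewrite S_INR.
      apply Rmax_lub; lra.
  - unfold count in *; simpl; rewrite (ind_false _ Hn); lra.
Qed.

Lemma count_unique (P : nat -> Prop) (n : nat) :
  (forall i j, P i -> P j -> i = j) -> count P n <= 1.
Proof.
  intros H; replace 1 with (0 + 1) by lra; apply count_window; [lra|].
  intros i j Hi Hj; rewrite (H i j Hi Hj); lra.
Qed.

Lemma bounded_count_finite (P : nat -> Prop) (B : R) :
  (forall n, count P n <= B) -> exists N, forall i, P i -> (i < N)%nat.
Proof.
  intros HB; apply NNPP; intros Hn.
  assert (Hinf : forall N, exists i, P i /\ (N <= i)%nat).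
  { intros N; apply NNPP; intros HN; apply Hn; exists N; intros i Hi.
    apply Nat.nle_gt; intros Hle; apply HN; eauto. }
  assert (Hbig : forall m, exists n, INR m <= count P n).
  { induction m as [|m [n Hm]]; [exists O; unfold count; simpl; lra|].
    destruct (Hinf n) as [i [Hi Hni]]; exists (S i).
    assert (count P n <= count P i)
      by (apply sumn_mono; [intros; apply ind_bounds|assumption]).
    rewrite S_INR; unfold count in *; simpl; rewrite (ind_true _ Hi); lra. }
  destruct (INR_unbounded B) as [m Hm]; destruct (Hbig m) as [n H].
  specialize (HB n); lra.
Qed.

Lemma max_below (f : nat -> nat) (n : nat) :
  exists K, forall i, (i < n)%nat -> (f i < K)%nat.
Proof.
  induction n as [|n [K HK]]; [exists O; lia|].
  exists (Nat.max K (S (f n))); intros i Hi.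
  destruct (Nat.eq_dec i n) as [->|]; [lia|]; specialize (HK i); lia.
Qed.

Lemma sumn_pick (f : nat -> R) (m n : nat) :
  (m < n)%nat -> sumn (fun i => ind (i = m) * f i) n = f m.
Proof.
  induction n as [|n IH]; [lia|]; intros Hm; simpl.
  destruct (Nat.eq_dec m n) as [->|Hne].
  - rewrite ind_true by reflexivity.
    rewrite (sumn_ext _ (fun _ => 0)), sumn_zero; [lra|].
    intros i Hi; rewrite ind_false by lia; lra.
  - rewrite IH, ind_false by lia; lra.
Qed.

(** Bounds the cost of covers indexed by pairs once they are listed as sequences: the first [N]
    codes lie in a finite rectangle, and injectivity of the coding uses each entry at most once. *)
Lemma sumn_cantor (f : nat -> nat -> R) (B : R) :
  (forall k n, 0 <= f k n) ->
  (forall K M, sumn (fun k => sumn (f k) M) K <= B) ->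
  forall N, sumn (fun i => f (fst (of_nat i)) (snd (of_nat i))) N <= B.
Proof.
  intros Hf HB N.
  destruct (max_below (fun i => fst (of_nat i)) N) as [K HK].
  destruct (max_below (fun i => snd (of_nat i)) N) as [M HM].
  eapply Rle_trans; [|apply (HB K M)].
  rewrite (sumn_ext _ (fun i => sumn (fun k => sumn (fun n =>
    ind (k = fst (of_nat i)) * (ind (n = snd (of_nat i)) * f k n)) M) K)).
  2:{ intros i Hi. rewrite (sumn_ext _ (fun k =>
        ind (k = fst (of_nat i)) * f k (snd (of_nat i)))).
      - now rewrite (sumn_pick (fun k => f k _)) by (apply HK; assumption).
      - intros k _; rewrite sumn_scal; f_equal.
        apply (sumn_pick (f k)); apply HM; assumption. }
  rewrite sumn_switch; apply sumn_le; intros k _.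
  rewrite sumn_switch; apply sumn_le; intros n _.
  apply Rle_trans with (f k n * count (fun i => i = to_nat (k, n)) N).
  - unfold count; rewrite <- sumn_scal; apply sumn_le; intros i _.
    pose proof (Hf k n).
    destruct (classic (k = fst (of_nat i) /\ n = snd (of_nat i))) as [[H1 H2]|Hno].
    + rewrite (ind_true _ H1), (ind_true _ H2), ind_true; [lra|].
      rewrite H1, H2, <- surjective_pairing, cancel_to_of; reflexivity.
    + pose proof (ind_bounds (i = to_nat (k, n))).
      apply Rle_trans with 0; [|nra].
      destruct (classic (k = fst (of_nat i))) as [H1|H1].
      * rewrite (ind_false (n = _)) by tauto; lra.
      * rewrite (ind_false _ H1); lra.
  - pose proof (Hf k n).
    pose proof (count_unique (fun i => i = to_nat (k, n)) N ltac:(congruence)).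
    nra.
Qed.

(** * Distances and diameters in the plane *)

Lemma dist2_sqr (p q : pt) :
  dist2 p q ^ 2 = (fst p - fst q) ^ 2 + (snd p - snd q) ^ 2.
Proof.
  unfold dist2; rewrite <- Rsqr_pow2, Rsqr_sqrt; [reflexivity|].
  apply Rplus_le_le_0_compat; apply pow2_ge_0.
Qed.

Lemma dist2_le (p q : pt) (D : R) :
  0 <= D -> (fst p - fst q) ^ 2 + (snd p - snd q) ^ 2 <= D ^ 2 -> dist2 p q <= D.
Proof.
  intros HD H; unfold dist2; rewrite <- (sqrt_pow2 D HD); apply sqrt_le_1_alt, H.
Qed.

Lemma diam_dist (A : set2) (d : R) (p q : pt) :
  is_diam A d -> A p -> A q -> dist2 p q <= d.
Proof.
  intros [[He _]|[Hub _]] Hp Hq; [destruct (He p Hp)|].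
  apply Hub; eauto.
Qed.

Lemma diam_nonneg (A : set2) (d : R) : is_diam A d -> 0 <= d.
Proof.
  intros HA; pose proof HA as [[_ ->]|[_ Hl]]; [lra|].
  destruct (classic (exists p, A p)) as [[p Hp]|Hn].
  - eapply Rle_trans; [|apply (diam_dist A d p p HA Hp Hp)]; apply sqrt_pos.
  (* When [A] is empty every real bounds the empty set of distances, so a least upper bound [d]
     would lie below [d - 1]. *)
  - assert (d <= d - 1); [|lra].
    apply Hl; intros x [p [q [Hp _]]]; destruct Hn; eauto.
Qed.

(** The last conjunct lets empty pieces of a cover cost nothing, as the gauge functions vanish at
    [0]. *)
Lemma diam_exists (A : set2) (D : R) :
  0 <= D -> (forall p q, A p -> A q -> dist2 p q <= D) ->
  exists d, is_diam A d /\ 0 <= d <= D /\ ((forall p, ~ A p) -> d = 0).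
Proof.
  intros HD H; destruct (classic (exists p, A p)) as [[p Hp]|Hn].
  - destruct (completeness (fun r => exists p q, A p /\ A q /\ r = dist2 p q))
      as [d Hd].
    + exists D; intros x [p' [q' [H1 [H2 ->]]]]; auto.
    + exists (dist2 p p); eauto.
    + exists d; assert (HA : is_diam A d) by (right; exact Hd).
      split; [exact HA|split; [split|]].
      * exact (diam_nonneg A d HA).
      * apply Hd; intros x [p' [q' [H1 [H2 ->]]]]; auto.
      * intros He; destruct (He p Hp).
  - exists 0; split; [left; split; [|reflexivity]|split; [lra|reflexivity]].
    intros p Hp; apply Hn; eauto.
Qed.

(** * Rich directions and the splitting of a segment *)

Definition on_line (b e : pt) (t : R) : pt := (fst b + t * fst e, snd b + t * snd e).

Definition level (d : nat -> R) (r : R) (i : nat) : Prop := r <= d i < 2 * r.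

Definition hits (U : nat -> set2) (b e : pt) (I : R -> Prop) (i : nat) : Prop :=
  exists t, I t /\ U i (on_line b e t).

Definition joined (U : nat -> set2) (eta : R) (e : pt) (i j : nat) : Prop :=
  exists p q s, U i p /\ U j q /\ eta <= s /\
    fst q - fst p = s * fst e /\ snd q - snd p = s * snd e.

(** In the applications [H] is three times a bound on the cost of one set of the class, [a] is the
    weight of the scale, and [N] exceeds all indices of the class. *)
Definition rich (U : nat -> set2) (d : nat -> R) (r eta H a : R) (N : nat) (e : pt) :
  Prop :=
  exists P Q : nat -> Prop,
    (forall i, P i -> level d r i) /\ (forall i, Q i -> level d r i) /\
    (forall i j, P i -> Q j -> joined U eta e i j) /\
    a <= H * count P N /\ a <= H * count Q N.

Lemma least_nat (P : nat -> Prop) (n : nat) :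
  P n -> exists m, P m /\ forall j, (j < m)%nat -> ~ P j.
Proof.
  induction n as [n IH] using lt_wf_ind; intros Hn.
  destruct (classic (exists j, (j < n)%nat /\ P j)) as [[j [Hj HP]]|H]; [eauto|].
  exists n; split; [assumption|]; intros j Hj HP; apply H; eauto.
Qed.

(* Sweep along the segment in steps of [eta] until the part swept so far is met by
   many sets; the part beyond the next step is then met by few. *)
Lemma poor_direction_split (U : nat -> set2) (d : nat -> R) (r eta H a : R) (N : nat)
  (e b : pt) (l : R) :
  0 < eta -> 0 < a -> ~ rich U d r eta H a N e ->
  exists u,
    H * count (fun i => level d r i /\
                 hits U b e (fun t => 0 <= t <= l /\ t <= u) i) N < a /\
    H * count (fun i => level d r i /\
                 hits U b e (fun t => 0 <= t <= l /\ u + 2 * eta <= t) i) N < a.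
Proof.
  intros Heta Ha Hpoor.
  set (A := fun u i => level d r i /\ hits U b e (fun t => 0 <= t <= l /\ t <= u) i).
  set (B := fun u i => level d r i /\ hits U b e (fun t => 0 <= t <= l /\ u <= t) i).
  assert (Hempty : forall P : nat -> Prop, (forall i, ~ P i) -> H * count P N < a)
    by (intros P HP; rewrite count_empty by assumption; lra).
  destruct (classic (exists j, a <= H * count (A (INR j * eta)) N)) as [[j0 Hj0]|Hno].
  - destruct (least_nat (fun j => a <= H * count (A (INR j * eta)) N) j0 Hj0)
      as [j [Hj Hmin]].
    (* By minimality of [j] the part up to [(j - 1) * eta] is light. The far part begins at
       [(j + 1) * eta], a distance [eta] beyond the heavy part up to [j * eta]. *)
    exists (INR j * eta - eta); split.
    + destruct j as [|j].
      (* For [j = 0] the bound is [- eta], below every parameter of the segment. *)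
      * apply Hempty; intros i [_ [t [Ht _]]]; simpl in Ht; lra.
      * replace (INR (S j) * eta - eta) with (INR j * eta) by (rewrite S_INR; ring).
        apply Rnot_le_lt; apply (Hmin j); lia.
    + replace (INR j * eta - eta + 2 * eta) with (INR j * eta + eta) by ring.
      apply Rnot_le_lt; intros HB; apply Hpoor.
      exists (A (INR j * eta)), (B (INR j * eta + eta)).
      split; [intros i [Hi _]; exact Hi|].
      split; [intros i [Hi _]; exact Hi|].
      split; [|split; assumption].
      intros i i' [_ [t [Ht Hp]]] [_ [t' [Ht' Hq]]].
      exists (on_line b e t), (on_line b e t'), (t' - t).
      simpl; repeat split; auto; try lra; ring.
  (* No initial part is heavy: take [u] past the end of the segment, so that nothing remains beyond
     it. *)
  - destruct (INR_unbounded (l / eta)) as [n Hn].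
    assert (Hl : l < INR n * eta).
    { apply (Rmult_lt_compat_r eta) in Hn; [|assumption].
      replace (l / eta * eta) with l in Hn by (field; lra); lra. }
    exists (INR n * eta); split.
    + apply Rnot_le_lt; intros HA; apply Hno; exists n; exact HA.
    + apply Hempty; intros i [_ [t [Ht _]]]; lra.
Qed.

Lemma line_window_diam (b e : pt) (u w : R) :
  circle e -> 0 <= w ->
  exists d, is_diam (fun p => exists t, u <= t <= u + w /\ p = on_line b e t) d /\
            0 <= d <= w.
Proof.
  intros He Hw.
  destruct (diam_exists (fun p => exists t, u <= t <= u + w /\ p = on_line b e t) w Hw)
    as [d [Hd [Hdw _]]]; [|eauto].
  intros p q [t [Ht ->]] [t' [Ht' ->]]; apply dist2_le; [assumption|].
  unfold circle in He; simpl fst; simpl snd.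
  replace (_ + _) with ((t - t') ^ 2 * (fst e ^ 2 + snd e ^ 2)) by ring.
  rewrite He; nra.
Qed.

(** If every scale were poor, a window of length [2 * eta k] and cost at most [a k / 3] could be cut
    out at each scale, leaving two sides whose sets in the class cost at most [a k / 3] each; hence
    the factor [3]. The total would be at most [1], against a content exceeding [1]. *)
Lemma exists_rich_level (hh : R -> R) (C delta : R) (E S : set2) (e : pt)
  (U : nat -> set2) (d r eta a : nat -> R) (N : nat -> nat) :
  classH hh -> 0 <= C -> (forall x, 0 <= x -> hh (2 * x) <= C * hh x) ->
  circle e -> segment_dir e S -> 0 < delta -> Hcontent_gt hh delta (inter S E) 1 ->
  (forall i, is_diam (U i) (d i) /\ d i < delta) ->
  (forall p, E p -> exists i, U i p) ->
  (forall k, 0 < r k) -> (forall k, 0 < a k) -> (forall K, sumn a K <= 1) ->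
  (forall k, 0 < eta k /\ 2 * eta k < delta /\ hh (2 * eta k) <= a k / 3) ->
  (forall i, 0 < d i -> exists k, level d (r k) i) ->
  (forall k i, level d (r k) i -> (i < N k)%nat) ->
  exists k, rich U d (r k) (eta k) (3 * C * hh (r k)) (a k) (N k) e.
Proof.
  intros [Hh0 [Hhpos [Hhmon _]]] HC Hdbl He [b [l [Hl HS]]] Hdelta [c' [Hc' Hcont]]
    HU HcovE Hr Ha Hasum Heta Hlev HN.
  apply NNPP; intros Hpoor.
  assert (Hsplit : forall k, exists u,
    3 * C * hh (r k) * count (fun i => level d (r k) i /\
       hits U b e (fun t => 0 <= t <= l /\ t <= u) i) (N k) < a k /\
    3 * C * hh (r k) * count (fun i => level d (r k) i /\
       hits U b e (fun t => 0 <= t <= l /\ u + 2 * eta k <= t) i) (N k) < a k).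
  { intros k; apply poor_direction_split; [apply Heta|apply Ha|].
    intros Hk; apply Hpoor; eauto. }
  apply functional_choice in Hsplit; destruct Hsplit as [u Hsplit].
  set (A := fun k i => level d (r k) i /\
       hits U b e (fun t => 0 <= t <= l /\ t <= u k) i).
  set (B := fun k i => level d (r k) i /\
       hits U b e (fun t => 0 <= t <= l /\ u k + 2 * eta k <= t) i).
  (* Slot [0] holds the window, slot [i + 1] the set [U i] if it is used at scale [k]. Sets of
     diameter [0] belong to no class; they are kept at every scale since [hh 0 = 0]. *)
  set (V := fun k n => match n with
    | O => fun p => exists t, u k <= t <= u k + 2 * eta k /\ p = on_line b e t
    | Datatypes.S i => fun p => U i p /\ (d i = 0 \/ A k i \/ B k i) end).
  assert (HV : forall x : nat * nat, exists dx, is_diam (V (fst x) (snd x)) dx /\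
    0 <= dx < delta /\
    hh dx <= match snd x with O => a (fst x) / 3
             | Datatypes.S i => C * hh (r (fst x)) * (ind (A (fst x) i) + ind (B (fst x) i)) end).
  { intros [k [|i]]; simpl.
    - destruct (Heta k) as [He1 [He2 He3]].
      destruct (line_window_diam b e (u k) (2 * eta k) He ltac:(lra)) as [dx [H1 H2]].
      exists dx; split; [exact H1|split; [lra|]].
      eapply Rle_trans; [|exact He3]; apply Hhmon; lra.
    - destruct (HU i) as [Hdi Hdid]; pose proof (diam_nonneg _ _ Hdi) as Hdi0.
      destruct (diam_exists (fun p => U i p /\ (d i = 0 \/ A k i \/ B k i)) (d i) Hdi0)
        as [dx [H1 [H2 H3]]].
      { intros p q [Hp _] [Hq _]; exact (diam_dist _ _ _ _ Hdi Hp Hq). }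
      exists dx; split; [exact H1|split; [lra|]].
      pose proof (ind_bounds (A k i)); pose proof (ind_bounds (B k i)).
      pose proof (Hr k); pose proof (Hhpos (r k) ltac:(lra)) as Hhr.
      assert (HChr : 0 <= C * hh (r k)) by nra.
      destruct (classic (A k i \/ B k i)) as [HAB|HAB].
      + assert (Hle : hh dx <= C * hh (r k)).
        { eapply Rle_trans; [|apply Hdbl; lra]; apply Hhmon; [lra|].
          destruct HAB as [[Hlv _]|[Hlv _]]; unfold level in Hlv; lra. }
        assert (1 <= ind (A k i) + ind (B k i)).
        { destruct HAB as [HA|HB]; [rewrite (ind_true _ HA)|rewrite (ind_true _ HB)]; lra. }
        nra.
      + assert (dx = 0) as ->.
        { destruct (Req_dec (d i) 0) as [Hd0|Hd0]; [lra|].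
          apply H3; intros p [_ [?|?]]; tauto. }
        rewrite Hh0; apply Rmult_le_pos; lra. }
  apply functional_choice in HV; destruct HV as [dV HV].
  assert (Hcost : forall K M, sumn (fun k => sumn (fun n => hh (dV (k, n))) M) K <= 1).
  { intros K M; eapply Rle_trans; [|apply (Hasum K)]; apply sumn_le; intros k _.
    (* The class has all its indices below [N k], so a count up to any [M] is controlled by the
       count up to [N k]. *)
    assert (Hcnt : forall P : nat -> Prop, (forall i, P i -> level d (r k) i) ->
      3 * C * hh (r k) * count P (N k) < a k -> C * hh (r k) * count P M <= a k / 3).
    { intros P HP HPa.
      pose proof (count_support P (N k) M (fun i Hi => HN k i (HP i Hi))).
      pose proof (Hr k); pose proof (Hhpos (r k) ltac:(lra)).
      assert (0 <= C * hh (r k)) by nra; nra. }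
    assert (HA : C * hh (r k) * count (A k) M <= a k / 3)
      by (apply Hcnt; [intros i [Hi _]; exact Hi|apply Hsplit]).
    assert (HB : C * hh (r k) * count (B k) M <= a k / 3)
      by (apply Hcnt; [intros i [Hi _]; exact Hi|apply Hsplit]).
    apply Rle_trans with (sumn (fun n => hh (dV (k, n))) (1 + M)).
    { apply sumn_mono; [|lia]; intros n; apply Hhpos, (HV (k, n)). }
    rewrite sumn_add.
    assert (H0 : sumn (fun n => hh (dV (k, n))) 1 <= a k / 3).
    { simpl; pose proof (HV (k, O)) as [_ [_ H0]]; simpl in H0; lra. }
    assert (H1 : sumn (fun i => hh (dV (k, (1 + i)%nat))) M <=
                 C * hh (r k) * (count (A k) M + count (B k) M)).
    { unfold count; rewrite <- sumn_plus, <- sumn_scal; apply sumn_le; intros i _.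
      exact (proj2 (proj2 (HV (k, Datatypes.S i)))). }
    lra. }
  destruct (Hcont (fun i => V (fst (of_nat i)) (snd (of_nat i)))
              (fun i => dV (of_nat i))) with (c' := 1) as [n Hn].
  - intros i; destruct (HV (of_nat i)) as [H1 [H2 _]]; split; [exact H1|lra].
  - intros p [HpS HpE].
    assert (HVp : exists k n, V k n p).
    { apply HS in HpS; destruct HpS as [t [Ht Hpt]].
      destruct (HcovE p HpE) as [i Hi].
      destruct (HU i) as [Hdi _]; apply diam_nonneg in Hdi.
      destruct (Req_dec (d i) 0) as [Hd0|Hd0].
      - exists O, (Datatypes.S i); simpl; auto.
      - destruct (Hlev i ltac:(lra)) as [k Hk].
        assert (Hpt' : U i (on_line b e t)) by (unfold on_line; rewrite <- Hpt; exact Hi).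
        exists k; destruct (Rle_dec t (u k)); [|destruct (Rle_dec (u k + 2 * eta k) t)].
        + exists (Datatypes.S i); simpl; split; [assumption|].
          right; left; split; [assumption|]; exists t; auto.
        + exists (Datatypes.S i); simpl; split; [assumption|].
          right; right; split; [assumption|]; exists t; auto.
        + exists O; simpl; exists t; split; [lra|exact Hpt]. }
    destruct HVp as [k [n HVp]]; exists (to_nat (k, n)); rewrite cancel_of_to; exact HVp.
  - assumption.
  - rewrite sum_f_R0_sumn in Hn.
    pose proof (sumn_cantor (fun k n => hh (dV (k, n))) 1
      ltac:(intros; apply Hhpos, (HV (k, n0))) Hcost (Datatypes.S n)) as H.
    rewrite (sumn_ext _ (fun i => hh (dV (of_nat i)))) in H; [lra|].
    intros i _; now rewrite <- surjective_pairing.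
Qed.

(** * Arcs of the unit circle *)

(* The four maps [turn c], [c < 4], carry the quarter arcs of the circle around the
   coordinate axes onto the upper one, where the abscissa is a bi-Lipschitz
   coordinate. *)
Definition turn (c : nat) (e : pt) : pt :=
  match c with
  | 0%nat => (fst e, snd e)
  | 1%nat => (fst e, - snd e)
  | 2%nat => (snd e, fst e)
  | _ => (snd e, - fst e)
  end.

(** The shift by [1] makes the abscissa nonnegative, so that natural numbers index the arcs. *)
Definition cell (c : nat) (rho : R) (m : nat) (e : pt) : Prop :=
  (c < 4)%nat /\ Rabs (fst (turn c e)) <= snd (turn c e) /\
  INR m * rho <= fst (turn c e) + 1 < (INR m + 1) * rho.

Lemma turn_isometry (c : nat) (e e' : pt) :
  (fst (turn c e) - fst (turn c e')) ^ 2 + (snd (turn c e) - snd (turn c e')) ^ 2 =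
  (fst e - fst e') ^ 2 + (snd e - snd e') ^ 2.
Proof. destruct c as [|[|[|c]]]; simpl; ring. Qed.

Lemma turn_circle (c : nat) (e : pt) : circle e -> circle (turn c e).
Proof. unfold circle; destruct c as [|[|[|c]]]; simpl; lra. Qed.

Lemma circle_cells (rho : R) (e : pt) :
  0 < rho -> circle e -> exists c m, cell c rho m e.
Proof.
  intros Hrho He.
  assert (Hc : exists c, (c < 4)%nat /\ Rabs (fst (turn c e)) <= snd (turn c e)).
  { destruct e as [x y]; unfold Rabs.
    destruct (Rle_dec x y), (Rle_dec (- x) y).
    - exists 0%nat; split; [lia|]; simpl; destruct (Rcase_abs x); lra.
    - exists 3%nat; split; [lia|]; simpl; destruct (Rcase_abs y); lra.
    - exists 2%nat; split; [lia|]; simpl; destruct (Rcase_abs y); lra.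
    - exists 1%nat; split; [lia|]; simpl; destruct (Rcase_abs x); lra. }
  destruct Hc as [c [Hc Habs]]; exists c.
  pose proof (turn_circle c e He) as Ht; unfold circle in Ht.
  destruct (turn c e) as [x y] eqn:Ee; simpl in Ht, Habs.
  assert (Hx : 0 <= x + 1) by nra.
  destruct (INR_unbounded ((x + 1) / rho)) as [n0 Hn0].
  assert (Hmul : forall t, (x + 1) / rho < t <-> x + 1 < t * rho).
  { intros t; split; intros H.
    - apply (Rmult_lt_compat_r rho) in H; [|assumption].
      replace ((x + 1) / rho * rho) with (x + 1) in H by (field; lra); lra.
    - apply (Rmult_lt_reg_r rho); [assumption|].
      replace ((x + 1) / rho * rho) with (x + 1) by (field; lra); lra. }
  destruct (least_nat (fun n => x + 1 < (INR n + 1) * rho) n0) as [m [Hm Hmin]].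
  { apply Hmul; lra. }
  exists m; unfold cell; rewrite Ee; simpl; repeat split; try assumption.
  destruct m as [|m]; [simpl; lra|].
  specialize (Hmin m ltac:(lia)); rewrite S_INR; lra.
Qed.

(** From [y^2 - y'^2 = x'^2 - x^2] and [|x + x'| <= y + y'] on the upper quarter arc, ordinates
    differ no more than abscissas. *)
Lemma cell_diam (c : nat) (rho : R) (m : nat) (e e' : pt) :
  0 < rho -> circle e -> circle e' -> cell c rho m e -> cell c rho m e' ->
  dist2 e e' <= 2 * rho.
Proof.
  intros Hrho He He' [_ [Hy Hm]] [_ [Hy' Hm']].
  apply dist2_le; [lra|]; rewrite <- (turn_isometry c).
  apply (turn_circle c) in He, He'; unfold circle in He, He'.
  set (x := fst (turn c e)) in *; set (y := snd (turn c e)) in *.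
  set (x' := fst (turn c e')) in *; set (y' := snd (turn c e')) in *.
  assert (Hd : (x - x') ^ 2 <= rho ^ 2).
  { apply pow_maj_Rabs; apply Rabs_le; lra. }
  assert (Hs : (x + x') ^ 2 <= (y + y') ^ 2).
  { apply pow_maj_Rabs; eapply Rle_trans; [apply Rabs_triang|lra]. }
  assert (Hpos : 0 < (y + y') ^ 2).
  { pose proof (Rabs_pos x'); apply pow_lt.
    apply Rplus_lt_le_0_compat; [|lra].
    apply Rnot_le_lt; intros Hy0; revert Hy; unfold Rabs.
    destruct (Rcase_abs x); nra. }
  assert (Hprod : (y - y') ^ 2 * (y + y') ^ 2 = (x - x') ^ 2 * (x + x') ^ 2).
  { replace (_ * _) with ((y ^ 2 - y' ^ 2) ^ 2) by ring.
    replace (y ^ 2 - y' ^ 2) with (x' ^ 2 - x ^ 2) by lra; ring. }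
  assert (Hle : (y - y') ^ 2 <= (x - x') ^ 2).
  { apply (Rmult_le_reg_r ((y + y') ^ 2)); [assumption|]; rewrite Hprod.
    apply Rmult_le_compat_l; [apply pow2_ge_0|assumption]. }
  pose proof (pow2_ge_0 rho); lra.
Qed.

(** * Counting rich arcs at one scale *)

(** The vectors [s e] and [s' e'] differ by at most [4 * r], since their endpoints lie in the same
    two sets of diameter below [2 * r]. For unit vectors [|s e - s' e'|^2 = (s - s')^2 + s s' |e -
    e'|^2], and [s s' >= eta^2]. *)
Lemma joined_directions_close (U : nat -> set2) (d : nat -> R) (r eta : R) (i j : nat)
  (e e' : pt) :
  (forall i, is_diam (U i) (d i)) -> level d r i -> level d r j -> 0 < eta ->
  circle e -> circle e' -> joined U eta e i j -> joined U eta e' i j ->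
  eta ^ 2 * ((fst e - fst e') ^ 2 + (snd e - snd e') ^ 2) <= (4 * r) ^ 2.
Proof.
  intros HU Hi Hj Heta He He' [p [q [s [Hp [Hq [Hs [E1 E2]]]]]]]
    [p' [q' [s' [Hp' [Hq' [Hs' [E1' E2']]]]]]].
  assert (Hsq : forall k x y, level d r k -> U k x -> U k y ->
    (fst x - fst y) ^ 2 + (snd x - snd y) ^ 2 <= 4 * r ^ 2).
  { intros k x y Hk Hx Hy; rewrite <- dist2_sqr; unfold level in Hk.
    pose proof (diam_dist _ _ _ _ (HU k) Hx Hy).
    assert (0 <= dist2 x y) by apply sqrt_pos; nra. }
  pose proof (Hsq i p p' Hi Hp Hp') as H1.
  pose proof (Hsq j q q' Hj Hq Hq') as H2.
  assert (H3 : (s * fst e - s' * fst e') ^ 2 + (s * snd e - s' * snd e') ^ 2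
               <= 16 * r ^ 2).
  { rewrite <- E1, <- E2, <- E1', <- E2'.
    pose proof (pow2_ge_0 (fst q - fst q' + (fst p - fst p'))).
    pose proof (pow2_ge_0 (snd q - snd q' + (snd p - snd p'))).
    nra. }
  assert (H4 : (s * fst e - s' * fst e') ^ 2 + (s * snd e - s' * snd e') ^ 2 =
    (s - s') ^ 2 + s * s' * ((fst e - fst e') ^ 2 + (snd e - snd e') ^ 2)).
  { unfold circle in He, He'.
    replace ((s - s') ^ 2) with (s ^ 2 * 1 + s' ^ 2 * 1 - s * s' * (1 + 1)) by ring.
    rewrite <- He at 1; rewrite <- He' at 1.
    replace (1 + 1) with
      (fst e ^ 2 + snd e ^ 2 + (fst e' ^ 2 + snd e' ^ 2)) by lra; ring. }
  assert (H5 : 0 <= (fst e - fst e') ^ 2 + (snd e - snd e') ^ 2)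
    by (apply Rplus_le_le_0_compat; apply pow2_ge_0).
  assert (H6 : eta ^ 2 <= s * s') by nra.
  pose proof (pow2_ge_0 (s - s')); nra.
Qed.

(* Double counting of the triples (cell, i, j) in which [U i] and [U j] are joined in
   the direction chosen in the cell: every rich cell gives many pairs, whereas a pair
   at distance at least [eta] determines the direction up to [4 * r / eta]. *)
Lemma rich_cells_count (U : nat -> set2) (d : nat -> R) (r eta H a : R) (N c M : nat)
  (L : set2) :
  (forall e, L e -> circle e) -> (forall i, is_diam (U i) (d i)) ->
  0 < r -> 0 < eta <= 1 -> 0 <= H -> 0 <= a ->
  count (fun m => exists e, L e /\ cell c (r / 2) m e /\ rich U d r eta H a N e) M
    * (a ^ 2 * eta) <= 10 * (H * count (level d r) N) ^ 2.
Proof.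
  intros HL HU Hr Heta HH Ha.
  set (T := fun m => exists e, L e /\ cell c (r / 2) m e /\ rich U d r eta H a N e).
  (* One rich direction with its two families is chosen per cell; the other cells receive a dummy
     value. *)
  assert (Hrep : forall m, exists x : pt * (nat -> Prop) * (nat -> Prop), T m ->
    circle (fst (fst x)) /\ cell c (r / 2) m (fst (fst x)) /\
    (forall i, snd (fst x) i -> level d r i) /\ (forall i, snd x i -> level d r i) /\
    (forall i j, snd (fst x) i -> snd x j -> joined U eta (fst (fst x)) i j) /\
    a <= H * count (snd (fst x)) N /\ a <= H * count (snd x) N).
  { intros m; destruct (classic (T m)) as [HT|HT].
    - destruct HT as [e [He [Hc [P [Q [H1 [H2 [H3 [H4 H5]]]]]]]]].
      exists (e, P, Q); intros _; simpl; auto 10.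
    - exists ((0, 0), fun _ => True, fun _ => True); tauto. }
  apply functional_choice in Hrep; destruct Hrep as [x Hx].
  set (P := fun m => snd (fst (x m))) in *; set (Q := fun m => snd (x m)) in *.
  set (e := fun m => fst (fst (x m))) in *.
  (* Each rich cell contributes at least [(a / H)^2] pairs; the inequality is cleared of division
     because [H] may be [0]. *)
  assert (Hpairs : count T M * a ^ 2 <= H ^ 2 * sumn (fun i => sumn (fun j =>
    count (fun m => T m /\ P m i /\ Q m j) M) N) N).
  { unfold count; rewrite Rmult_comm, <- sumn_scal.
    rewrite (sumn_ext (fun i => sumn (fun j => sumn (fun m => _) M) N)
      (fun i => sumn (fun m => sumn (fun j => ind (T m /\ P m i /\ Q m j)) N) M) N)
      by (intros i _; apply sumn_switch).
    rewrite sumn_switch, <- sumn_scal; apply sumn_le; intros m _.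
    destruct (classic (T m)) as [HT|HT].
    - rewrite (ind_true _ HT).
      destruct (Hx m HT) as [_ [_ [_ [_ [_ [H1 H2]]]]]].
      fold (P m) in H1; fold (Q m) in H2.
      apply Rle_trans with (H ^ 2 * (count (P m) N * count (Q m) N)); [nra|].
      apply Rmult_le_compat_l; [apply pow2_ge_0|].
      unfold count; rewrite sumn_mul; apply sumn_le; intros i _.
      apply sumn_le; intros j _.
      destruct (classic (P m i)) as [HP|HP];
        [|rewrite (ind_false _ HP); rewrite Rmult_0_l; apply ind_bounds].
      destruct (classic (Q m j)) as [HQ|HQ];
        [|rewrite (ind_false _ HQ); rewrite Rmult_0_r; apply ind_bounds].
      rewrite !ind_true by tauto; lra.
    - rewrite (ind_false _ HT), Rmult_0_r.
      apply Rmult_le_pos; [apply pow2_ge_0|].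
      apply sumn_nonneg; intros i; apply sumn_nonneg; intros j; apply ind_bounds. }
  (* Abscissas within [4 * r / eta] lie in cells of width [r / 2] whose indices differ by at most
     [8 / eta + 1]. Counting adds [1], and [eta <= 1] absorbs the resulting [2] into [10 / eta]. *)
  assert (Hfew : forall i j, count (fun m => T m /\ P m i /\ Q m j) M <=
    10 / eta * (ind (level d r i) * ind (level d r j))).
  { intros i j.
    destruct (classic (level d r i /\ level d r j)) as [[Hi Hj]|Hno].
    - rewrite (ind_true _ Hi), (ind_true _ Hj).
      assert (H1 : 1 <= / eta)
        by (rewrite <- Rinv_1; apply Rinv_le_contravar; lra).
      apply Rle_trans with (1 + 8 / eta + 1); [|unfold Rdiv; lra].
      apply count_window; [unfold Rdiv; lra|].
      intros m m' [HT [HP HQ]] [HT' [HP' HQ']].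
      destruct (Hx m HT) as [He [[_ [_ Hm]] [_ [_ [Hjn _]]]]].
      destruct (Hx m' HT') as [He' [[_ [_ Hm']] [_ [_ [Hjn' _]]]]].
      fold (e m) in *; fold (e m') in *.
      pose proof (joined_directions_close U d r eta i j (e m) (e m') HU Hi Hj
        (proj1 Heta) He He' (Hjn i j HP HQ) (Hjn' i j HP' HQ')) as Hcl.
      rewrite <- (turn_isometry c) in Hcl.
      set (u := fst (turn c (e m))) in *; set (u' := fst (turn c (e m'))) in *.
      assert (Hu : (eta * (u' - u)) ^ 2 <= (4 * r) ^ 2).
      { pose proof (pow2_ge_0 (snd (turn c (e m)) - snd (turn c (e m')))).
        pose proof (pow2_ge_0 eta); nra. }
      assert (Hu' : eta * (u' - u) <= 4 * r).
      { apply Rsqr_incr_0_var; [rewrite !Rsqr_pow2; exact Hu|lra]. }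
      apply (Rmult_le_reg_r (eta * (r / 2))); [apply Rmult_lt_0_compat; lra|].
      replace ((1 + 8 / eta) * (eta * (r / 2))) with (eta * (r / 2) + 4 * r)
        by (field; lra).
      assert (Hstep : (INR m' - INR m) * (r / 2) <= u' - u + r / 2) by lra.
      apply (Rmult_le_compat_l eta) in Hstep; lra.
    - rewrite count_empty.
      + apply Rmult_le_pos.
        * apply Rmult_le_pos; [lra|]; apply Rlt_le, Rinv_0_lt_compat; lra.
        * apply Rmult_le_pos; apply ind_bounds.
      + intros m [HT [HP HQ]]; apply Hno.
        destruct (Hx m HT) as [_ [_ [H1 [H2 _]]]]; auto. }
  assert (Htot : sumn (fun i => sumn (fun j =>
    count (fun m => T m /\ P m i /\ Q m j) M) N) N <=
    10 / eta * (count (level d r) N * count (level d r) N)).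
  { unfold count at 2 3; rewrite sumn_mul, <- sumn_scal; apply sumn_le; intros i _.
    rewrite <- sumn_scal; apply sumn_le; intros j _; apply Hfew. }
  apply Rle_trans with (H ^ 2 * (10 / eta * (count (level d r) N * count (level d r) N))
    * eta).
  - rewrite <- Rmult_assoc; apply Rmult_le_compat_r; [lra|].
    eapply Rle_trans; [exact Hpairs|].
    apply Rmult_le_compat_l; [apply pow2_ge_0|exact Htot].
  - apply Req_le; field; lra.
Qed.

(** * Covering all rich directions *)

(** The rich cells of all scales cover [L]. Abscissa width [r k / 2] makes their diameter at most
    [r k], and [rich_cells_count] with the hypothesis on [B] bounds their cost by [B k] per quarter
    arc, hence the [4]. *)
Lemma rich_directions_content (gg : R -> R) (delta c T : R) (L : set2)
  (U : nat -> set2) (d r eta H a B : nat -> R) (N : nat -> nat) :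
  classH gg -> (forall e, L e -> circle e) -> Hcontent_ge gg delta L c ->
  (forall i, is_diam (U i) (d i)) ->
  (forall k, 0 < r k < delta) -> (forall k, 0 < eta k <= 1) ->
  (forall k, 0 <= H k) -> (forall k, 0 < a k) ->
  (forall k, 0 <= B k) -> (forall K, sumn B K <= T) ->
  (forall k, gg (r k) * (10 * (H k * count (level d (r k)) (N k)) ^ 2) <=
             B k * (a k ^ 2 * eta k)) ->
  (forall e, L e -> exists k, rich U d (r k) (eta k) (H k) (a k) (N k) e) ->
  c <= 4 * T.
Proof.
  intros [Hg0 [Hgpos [Hgmon _]]] HL Hcont HU Hr Heta HH Ha HB HT Hbound Hrich.
  (* Cells are cut down to the rich directions of [L]: a cell without any is empty and costs
     nothing. *)
  set (W := fun k q m e => L e /\ cell q (r k / 2) m e /\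
                           rich U d (r k) (eta k) (H k) (a k) (N k) e).
  assert (HW : forall x : nat * (nat * nat), exists dx,
    is_diam (W (fst x) (fst (snd x)) (snd (snd x))) dx /\ 0 <= dx < delta /\
    gg dx <= gg (r (fst x)) *
             ind (exists e, W (fst x) (fst (snd x)) (snd (snd x)) e)).
  { intros [k [q m]]; simpl fst; simpl snd; pose proof (Hr k) as Hrk.
    destruct (diam_exists (W k q m) (r k) ltac:(lra)) as [dx [H1 [H2 H3]]].
    { intros e e' [He [Hc _]] [He' [Hc' _]].
      replace (r k) with (2 * (r k / 2)) by field.
      apply (cell_diam q _ m); auto; lra. }
    exists dx; split; [exact H1|split; [lra|]].
    destruct (classic (exists e, W k q m e)) as [Hex|Hex].
    - rewrite (ind_true _ Hex), Rmult_1_r; apply Hgmon; lra.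
    - rewrite (ind_false _ Hex), H3; [lra|]; intros e He; apply Hex; eauto. }
  apply functional_choice in HW; destruct HW as [dW HW].
  assert (Hcell : forall k q M, sumn (fun m => gg (dW (k, (q, m)))) M <=
                                B k * ind (q < 4)%nat).
  { intros k q M; pose proof (Hr k) as Hrk.
    pose proof (Hgpos (r k) ltac:(lra)) as Hgr.
    apply Rle_trans with (gg (r k) * count (fun m => exists e, W k q m e) M).
    { unfold count; rewrite <- sumn_scal; apply sumn_le; intros m _.
      apply (HW (k, (q, m))). }
    destruct (classic (q < 4)%nat) as [Hq|Hq].
    - rewrite (ind_true _ Hq), Rmult_1_r.
      pose proof (rich_cells_count U d (r k) (eta k) (H k) (a k) (N k) q M L HL HU
        (proj1 Hrk) (Heta k) (HH k) (Rlt_le _ _ (Ha k))) as Hcnt.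
      assert (Hpos : 0 < a k ^ 2 * eta k)
        by (apply Rmult_lt_0_compat; [apply pow_lt, Ha|apply Heta]).
      apply (Rmult_le_reg_r _ _ _ Hpos).
      eapply Rle_trans; [|apply Hbound].
      rewrite Rmult_assoc; apply Rmult_le_compat_l; [exact Hgr|exact Hcnt].
    - rewrite (ind_false _ Hq), count_empty; [lra|].
      intros m [e [_ [[Hq' _] _]]]; auto. }
  (* Quarter arc and cell number are coded by one [n], so that the flattening of double sums applies
     twice. *)
  set (f := fun k n => gg (dW (k, of_nat n))).
  assert (Hf : forall k n, 0 <= f k n) by (intros; apply Hgpos, HW).
  assert (Hlevel : forall k M, sumn (f k) M <= 4 * B k).
  { intros k; pose proof (sumn_cantor (fun q m => gg (dW (k, (q, m)))) (4 * B k)) as HC.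
    intros M; unfold f.
    rewrite (sumn_ext _ (fun n => gg (dW (k, (fst (of_nat n), snd (of_nat n))))))
      by (intros; now rewrite <- surjective_pairing).
    apply HC; [intros; apply Hgpos, HW|]; intros K M'.
    apply Rle_trans with (B k * count (fun q => (q < 4)%nat) K).
    - unfold count; rewrite <- sumn_scal; apply sumn_le; intros q _; apply Hcell.
    - pose proof (count_support (fun q => (q < 4)%nat) 4 K (fun i Hi => Hi)) as H4.
      assert (H4' : count (fun q => (q < 4)%nat) 4 <= 4).
      { unfold count; simpl; rewrite !ind_true by lia; lra. }
      pose proof (HB k); nra. }
  apply Rnot_lt_le; intros Hlt.
  destruct (Hcont (fun i => let x := (fst (of_nat i), of_nat (snd (of_nat i))) in
                     W (fst x) (fst (snd x)) (snd (snd x)))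
              (fun i => dW (fst (of_nat i), of_nat (snd (of_nat i))))) with (c' := 4 * T)
    as [n Hn].
  - intros i; pose proof (HW (fst (of_nat i), of_nat (snd (of_nat i)))) as [H1 [H2 _]].
    split; [exact H1|lra].
  - intros e He; destruct (Hrich e He) as [k Hk].
    destruct (circle_cells (r k / 2) e) as [q [m Hc]]; [pose proof (Hr k); lra|auto|].
    exists (to_nat (k, to_nat (q, m))); cbv zeta.
    rewrite cancel_of_to; cbn [fst snd]; rewrite cancel_of_to; split; auto.
  - exact Hlt.
  - rewrite sum_f_R0_sumn in Hn.
    pose proof (sumn_cantor f (4 * T) Hf) as HC.
    assert (Hsum : forall K M, sumn (fun k => sumn (f k) M) K <= 4 * T).
    { intros K M; apply Rle_trans with (4 * sumn B K); [|pose proof (HT K); lra].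
      rewrite <- sumn_scal; apply sumn_le; intros k _; apply Hlevel. }
    specialize (HC Hsum (S n)); unfold f in HC; simpl in Hn, HC; lra.
Qed.

(** * Dyadic scales and weights *)

Lemma pow_half_double (m n : nat) : (m < n)%nat -> 2 * (/ 2) ^ n <= (/ 2) ^ m.
Proof.
  intros Hmn; replace n with (S (n - S m) + m)%nat by lia.
  rewrite pow_add; cbn [pow].
  assert (H1 : (/ 2) ^ (n - S m) <= 1).
  { rewrite <- (pow1 (n - S m)); apply pow_incr; lra. }
  assert (H2 : 0 < (/ 2) ^ m) by (apply pow_lt; lra).
  nra.
Qed.

Lemma sumn_geom_half (K : nat) : sumn (fun k => (/ 2) ^ k) K <= 2.
Proof.
  assert (E : sumn (fun k => (/ 2) ^ k) K = 2 - 2 * (/ 2) ^ K)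
    by (induction K as [|K IH]; simpl; [|rewrite IH]; lra).
  pose proof (pow_lt (/ 2) K ltac:(lra)); lra.
Qed.

Lemma dyadic_level (d : nat -> R) (k0 i : nat) :
  0 < d i < 2 * (/ 2) ^ k0 -> exists k, level d ((/ 2) ^ (k0 + k)) i.
Proof.
  intros Hd.
  assert (Hex : exists n, (/ 2) ^ (k0 + n) <= d i).
  { destruct (pow_lt_1_zero (/ 2)) with (y := d i) as [n Hn]; [|lra|].
    - rewrite Rabs_right; lra.
    - exists n; specialize (Hn (k0 + n)%nat ltac:(lia)).
      apply Rabs_def2 in Hn; lra. }
  destruct Hex as [n Hn].
  destruct (least_nat (fun n => (/ 2) ^ (k0 + n) <= d i) n Hn) as [k [Hk Hmin]].
  exists k; split; [exact Hk|].
  (* At the coarsest scale the hypothesis on [d i] replaces minimality. *)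
  destruct k as [|k]; [rewrite Nat.add_0_r; lra|].
  specialize (Hmin k ltac:(lia)); rewrite Nat.add_succ_r; cbn [pow]; lra.
Qed.

(** The classes are disjoint, so each [f i] is counted at most once. *)
Lemma sum_over_levels (f d r : nat -> R) (N : nat -> nat) (mu : R) (K : nat) :
  (forall i, 0 <= f i) -> (forall n, sumn f n <= mu) ->
  (forall i k k', level d (r k) i -> level d (r k') i -> k = k') ->
  sumn (fun k => sumn (fun i => ind (level d (r k) i) * f i) (N k)) K <= mu.
Proof.
  intros Hf Hmu Huniq; destruct (max_below N K) as [n Hn].
  apply Rle_trans with (sumn f n); [|apply Hmu].
  apply Rle_trans with
    (sumn (fun k => sumn (fun i => ind (level d (r k) i) * f i) n) K).
  - apply sumn_le; intros k Hk; apply sumn_mono; [|specialize (Hn k Hk); lia].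
    intros i; apply Rmult_le_pos; [apply ind_bounds|apply Hf].
  - rewrite sumn_switch; apply sumn_le; intros i _.
    rewrite (sumn_ext _ (fun k => f i * ind (level d (r k) i)))
      by (intros; apply Rmult_comm).
    rewrite sumn_scal.
    pose proof (count_unique (fun k => level d (r k) i) K (Huniq i)) as H.
    unfold count in H; pose proof (Hf i); nra.
Qed.

(** Provides the constant in [eta = kappa * a^(1/alpha)], for which [c * (2 * eta)^alpha = c * (2 *
    kappa)^alpha * a <= a / 3]. *)
Lemma small_scale (c alpha x0 : R) :
  0 < c -> 0 < alpha -> 0 < x0 ->
  exists kappa, 0 < kappa <= 1 /\ 2 * kappa < x0 /\ c * Rpower (2 * kappa) alpha <= / 3.
Proof.
  intros Hc Ha Hx0.
  (* [y] solves [c * y^alpha = 1 / 3]. *)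
  set (y := Rpower (/ (3 * c)) (/ alpha)).
  assert (Hy : 0 < y) by apply exp_pos.
  set (m := Rmin 1 (Rmin x0 y)).
  assert (Hm1 : m <= 1) by apply Rmin_l.
  assert (Hm2 : m <= x0) by (eapply Rle_trans; [apply Rmin_r|apply Rmin_l]).
  assert (Hm3 : m <= y) by (eapply Rle_trans; [apply Rmin_r|apply Rmin_r]).
  assert (Hm : 0 < m) by (repeat apply Rmin_glb_lt; lra).
  exists (m / 4); split; [lra|split; [lra|]].
  apply Rle_trans with (c * Rpower y alpha).
  - apply Rmult_le_compat_l; [lra|]; apply Rle_Rpower_l; lra.
  - unfold y; rewrite Rpower_mult, Rinv_l, Rpower_1 by
      (try lra; apply Rinv_0_lt_compat; lra).
    apply Req_le; field; lra.
Qed.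

(* The exponent of the hypothesis is the one for which [theta * (2 + 1 / alpha) = 2]. *)
Lemma weight_bound (rho a S alpha : R) :
  0 < alpha -> 0 <= rho -> 0 < a -> 0 < S ->
  rpow rho (2 * alpha / (2 * alpha + 1)) <= S * a ->
  rho ^ 2 <= Rpower S (2 + / alpha) * (a ^ 2 * Rpower a (/ alpha)).
Proof.
  intros Halpha Hrho Ha HS; unfold rpow; destruct (Rle_dec rho 0) as [H0|H0]; intros H.
  - replace rho with 0 by lra; rewrite pow_i by lia.
    apply Rlt_le; repeat apply Rmult_lt_0_compat; try apply exp_pos; simpl; lra.
  - assert (Hq : 0 < / alpha) by (apply Rinv_0_lt_compat; lra).
    rewrite <- !Rpower_pow by lra; simpl INR; replace (1 + 1) with 2 by ring.
    rewrite <- Rpower_plus, Rpower_mult_distr by assumption.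
    replace 2 with (2 * alpha / (2 * alpha + 1) * (2 + / alpha)) at 1 by (field; lra).
    rewrite <- Rpower_mult.
    apply Rle_Rpower_l; [lra|split; [apply exp_pos|exact H]].
Qed.

(** Each member of the class adds at least [h r] to the sum, so there are at most [mu / h r] of
    them. *)
Lemma level_finite (h : R -> R) (d : nat -> R) (r mu : R) :
  classH h -> (forall i, 0 <= d i) -> 0 <= r -> 0 < h r ->
  (forall n, sumn (fun i => h (d i)) n <= mu) ->
  exists N, forall i, level d r i -> (i < N)%nat.
Proof.
  intros [_ [Hpos [Hmon _]]] Hd Hr Hhr Hmu.
  apply (bounded_count_finite _ (mu / h r)); intros n.
  apply (Rmult_le_reg_r (h r)); [assumption|].
  replace (mu / h r * h r) with mu by (field; lra).
  eapply Rle_trans; [|apply (Hmu n)].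
  rewrite Rmult_comm; unfold count; rewrite <- sumn_scal; apply sumn_le; intros i _.
  destruct (classic (level d r i)) as [Hi|Hi].
  - rewrite (ind_true _ Hi), Rmult_1_r; apply Hmon; [lra|apply Hi].
  - rewrite (ind_false _ Hi), Rmult_0_r; apply Hpos, Hd.
Qed.

(** * The estimate for a single cover *)

(* The quantitative core: the scales [r], weights [a] and lengths [eta] are fixed
   before the cover, so that [G] does not depend on the cover. *)
Lemma cover_sum_lower_bound (gg hh h : R -> R) (C delta deltag c G : R) (E L : set2)
  (k0 : nat) (eta a : nat -> R) (U : nat -> set2) (d : nat -> R) (mu : R) :
  let r k := (/ 2) ^ (k0 + k) in
  classH gg -> classH hh -> classH h -> 0 <= C ->
  (forall x, 0 <= x -> hh (2 * x) <= C * hh x) ->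
  (forall e, L e -> circle e) -> Hcontent_ge gg deltag L c ->
  (forall e, L e -> exists S, segment_dir e S /\ Hcontent_gt hh delta (inter S E) 1) ->
  2 * (/ 2) ^ k0 < delta -> (/ 2) ^ k0 < deltag ->
  (forall k, 0 < h (r k)) -> (forall k, 0 < a k) -> (forall K, sumn a K <= 1) ->
  (forall k, 0 < eta k <= 1 /\ 2 * eta k < delta /\ hh (2 * eta k) <= a k / 3) ->
  0 <= G ->
  (forall k, (hh (r k) * sqrt (gg (r k)) / h (r k)) ^ 2 <= G * (a k ^ 2 * eta k)) ->
  (forall i, is_diam (U i) (d i) /\ d i < 2 * (/ 2) ^ k0) ->
  (forall p, E p -> exists i, U i p) ->
  (forall n, sumn (fun i => h (d i)) n <= mu) ->
  c <= 360 * C ^ 2 * G * mu ^ 2.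
Proof.
  intros r Hgg Hhh Hh HC Hdbl HL Hcont Hseg Hk0 Hk0g Hhr Ha Hasum Heta HG Hratio HU
    Hcov Hmu.
  assert (Hr : forall k, 0 < r k <= (/ 2) ^ k0).
  { intros k; split; [apply pow_lt; lra|]; unfold r.
    destruct k as [|k]; [rewrite Nat.add_0_r; lra|].
    pose proof (pow_half_double k0 (k0 + S k) ltac:(lia)).
    pose proof (pow_lt (/ 2) (k0 + S k) ltac:(lra)); lra. }
  assert (Hd : forall i, 0 <= d i) by (intros i; apply (diam_nonneg (U i)), HU).
  assert (HN : forall k, exists N, forall i, level d (r k) i -> (i < N)%nat).
  { intros k; apply (level_finite h d (r k) mu); auto; apply Rlt_le, Hr. }
  apply functional_choice in HN; destruct HN as [N HN].
  assert (Huniq : forall i k k', level d (r k) i -> level d (r k') i -> k = k').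
  { assert (Hlt : forall i k k', level d (r k) i -> level d (r k') i -> ~ (k < k')%nat).
    { intros i k k' [Hk _] [_ Hk'] Hlt; unfold r in *.
      pose proof (pow_half_double (k0 + k) (k0 + k') ltac:(lia)); lra. }
    intros i k k' Hk Hk'; pose proof (Hlt i k k' Hk Hk'); pose proof (Hlt i k' k Hk' Hk).
    lia. }
  (* [X k] is at most the part of the cover sum that comes from the class of scale [k]. *)
  set (X := fun k => h (r k) * count (level d (r k)) (N k)).
  assert (HX0 : forall k, 0 <= X k).
  { intros k; apply Rmult_le_pos; [apply Rlt_le, Hhr|apply count_nonneg]. }
  destruct Hh as [_ [Hhpos [Hhmon _]]].
  assert (HX : forall K, sumn X K <= mu).
  { intros K.
    eapply Rle_trans; [|apply (sum_over_levels (fun i => h (d i)) d r N mu K); auto].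
    apply sumn_le; intros k _; unfold X, count; rewrite <- sumn_scal.
    apply sumn_le; intros i _.
    destruct (classic (level d (r k) i)) as [Hi|Hi].
    - rewrite (ind_true _ Hi), Rmult_1_r, Rmult_1_l.
      apply Hhmon; [apply Rlt_le, Hr|apply Hi].
    - rewrite (ind_false _ Hi); lra. }
  assert (Hmu0 : 0 <= mu) by apply (Hmu O).
  assert (HC2 : 0 <= C ^ 2) by apply pow2_ge_0.
  assert (HG0 : 0 <= 90 * C ^ 2 * G) by (apply Rmult_le_pos; lra).
  replace (360 * C ^ 2 * G * mu ^ 2) with (4 * (90 * C ^ 2 * G * mu ^ 2)) by ring.
  pose proof Hhh as [_ [Hhhpos _]]; pose proof Hgg as [_ [Hggpos _]].
  (* [90] is [10 * 3^2], from the count of rich cells and the factor [3] in [H]; the four quarter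
     arcs turn it into [360]. *)
  apply (rich_directions_content gg deltag c (90 * C ^ 2 * G * mu ^ 2) L U d r eta
    (fun k => 3 * C * hh (r k)) a (fun k => 90 * C ^ 2 * G * X k ^ 2) N); auto.
  - intros i; apply HU.
  - intros k; pose proof (Hr k); lra.
  - intros k; apply Heta.
  - intros k; apply Rmult_le_pos; [lra|]; apply Hhhpos, Rlt_le, Hr.
  - intros k; apply Rmult_le_pos; [assumption|apply pow2_ge_0].
  - intros K; rewrite sumn_scal; apply Rmult_le_compat_l; [assumption|].
    eapply Rle_trans; [apply sumn_sqr_le, HX0|].
    apply pow_incr; split; [apply sumn_nonneg, HX0|apply HX].
  - intros k; unfold X.
    set (n := count (level d (r k)) (N k)).
    set (rho := hh (r k) * sqrt (gg (r k)) / h (r k)).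
    (* Expresses the [gg]-cost through the cost [h] and the ratio [rho], which [Hratio] controls. *)
    assert (Hrho : hh (r k) ^ 2 * gg (r k) = rho ^ 2 * h (r k) ^ 2).
    { unfold rho.
      rewrite <- (pow2_sqrt (gg (r k))) at 1 by (apply Hggpos, Rlt_le, Hr).
      field; pose proof (Hhr k); lra. }
    replace (gg (r k) * _) with (90 * C ^ 2 * (h (r k) * n) ^ 2 * rho ^ 2).
    2:{ replace (gg (r k) * _) with (90 * C ^ 2 * n ^ 2 * (hh (r k) ^ 2 * gg (r k)))
          by ring.
        rewrite Hrho; ring. }
    replace (90 * C ^ 2 * G * (h (r k) * n) ^ 2 * (a k ^ 2 * eta k)) with
      (90 * C ^ 2 * (h (r k) * n) ^ 2 * (G * (a k ^ 2 * eta k))) by ring.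
    apply Rmult_le_compat_l; [|apply Hratio].
    apply Rmult_le_pos; [lra|apply pow2_ge_0].
  - intros e He; destruct (Hseg e He) as [S [HS HSE]].
    pose proof (Hr O).
    apply (exists_rich_level hh C delta E S e U d r eta a N); auto.
    + lra.
    + intros i; destruct (HU i) as [H1 H2]; split; [exact H1|lra].
    + intros k; apply Hr.
    + intros k; destruct (Heta k) as [H1 [H2 H3]]; lra.
    + intros i Hi; apply dyadic_level; split; [exact Hi|apply HU].
Qed.

(** * Choice of the constants and conclusion *)

Theorem theorem4p3 (gg hh h : R -> R) (alpha : R) (E : set2) :
  classH gg -> classHd hh ->
  0 < alpha < 1 ->
  (exists c x0, 0 < c /\ 0 < x0 /\
     forall x, 0 < x < x0 -> hh x <= c * rpow x alpha) ->
  F_set hh gg E ->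
  classH h ->
  prec h (fun x => hh x * sqrt (gg x)) ->
  (exists l, infinite_sum
     (fun k => rpow (hh ((/2) ^ k) * sqrt (gg ((/2) ^ k)) / h ((/2) ^ k))
                    (2 * alpha / (2 * alpha + 1))) l) ->
  Hmeasure_pos h E.
Proof.
  intros Hgg [Hhh [C [HC Hdbl]]] Halpha [c [x0 [Hc [Hx0 Hgrow]]]]
    [L [HL [[deltag [Hdg [cg [Hcg Hcont]]]] [dE [HdE Hseg]]]]] Hh [[d0 [Hd0 Hnz]] _]
    [l Hsum].
  set (ratio := fun k => hh ((/ 2) ^ k) * sqrt (gg ((/ 2) ^ k)) / h ((/ 2) ^ k)) in *.
  set (theta := 2 * alpha / (2 * alpha + 1)) in *.
  assert (Hterm : forall k, 0 <= rpow (ratio k) theta).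
  { intros k; unfold rpow; destruct (Rle_dec (ratio k) 0);
      [lra|apply Rlt_le, exp_pos]. }
  assert (Hpart : forall K, sumn (fun k => rpow (ratio k) theta) K <= l).
  { intros K; apply Rle_trans with (sumn (fun k => rpow (ratio k) theta) (S K));
      [apply sumn_mono; auto|].
    rewrite <- sum_f_R0_sumn; apply sum_incr; [exact Hsum|exact Hterm]. }
  assert (Hl : 0 <= l) by apply (Hpart O).
  (* [dE / 2] lies in the open range of the segment condition. [S] normalises the weights: [l]
     bounds the sum of the powers of [ratio], and [2] the geometric series. *)
  set (delta := dE / 2); set (S := l + 2).
  destruct (small_scale c alpha (Rmin x0 delta)) as [kappa [Hkap [Hkapx Hkapc]]];
    [lra|lra|apply Rmin_glb_lt; unfold delta; lra|].
  pose proof (Rmin_l x0 delta); pose proof (Rmin_r x0 delta).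
  (* Scales below [m / 2] keep [h] nonzero, the arcs admissible for the content of [L], and the
     covering sets admissible for the segments. *)
  set (m := Rmin d0 (Rmin deltag delta)).
  assert (Hm1 : m <= d0) by apply Rmin_l.
  assert (Hm2 : m <= deltag) by (eapply Rle_trans; [apply Rmin_r|apply Rmin_l]).
  assert (Hm3 : m <= delta) by (eapply Rle_trans; [apply Rmin_r|apply Rmin_r]).
  assert (Hm : 0 < m) by (repeat apply Rmin_glb_lt; unfold delta; lra).
  destruct (pow_lt_1_zero (/ 2) ltac:(rewrite Rabs_right; lra) (m / 2) ltac:(lra))
    as [k0 Hk0].
  assert (Hsmall : forall k, 0 < (/ 2) ^ (k0 + k) < m / 2).
  { intros k; split; [apply pow_lt; lra|].
    specialize (Hk0 (k0 + k)%nat ltac:(lia)); apply Rabs_def2 in Hk0; lra. }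
  pose proof (Hsmall O) as Hsmall0; rewrite Nat.add_0_r in Hsmall0.
  (* The summand [(1/2)^k] keeps the weights positive even when [ratio] vanishes. *)
  set (a := fun k => (rpow (ratio (k0 + k)%nat) theta + (/ 2) ^ k) / S).
  set (eta := fun k => kappa * Rpower (a k) (/ alpha)).
  assert (HS : 0 < S) by (unfold S; lra).
  assert (Ha : forall k, 0 < a k).
  { intros k; apply Rdiv_lt_0_compat; [|assumption].
    pose proof (Hterm (k0 + k)%nat); pose proof (pow_lt (/ 2) k ltac:(lra)); lra. }
  assert (Hasum : forall K, sumn a K <= 1).
  { intros K; unfold a, Rdiv.
    rewrite (sumn_ext _ (fun k => / S * (rpow (ratio (k0 + k)%nat) theta + (/ 2) ^ k)))
      by (intros; apply Rmult_comm).
    rewrite sumn_scal, sumn_plus.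
    apply (Rmult_le_reg_l S); [assumption|].
    rewrite <- Rmult_assoc, Rinv_r, Rmult_1_l, Rmult_1_r by lra.
    apply Rplus_le_compat; [|apply sumn_geom_half].
    pose proof (Hpart (k0 + K)%nat) as HK; rewrite sumn_add in HK.
    pose proof (sumn_nonneg (fun k => rpow (ratio k) theta) k0 Hterm); lra. }
  assert (Ha1 : forall k, a k <= 1).
  { intros k; eapply Rle_trans; [|apply (Hasum (Datatypes.S k))]; simpl.
    pose proof (sumn_nonneg a k (fun i => Rlt_le _ _ (Ha i))); lra. }
  assert (Heta : forall k, 0 < eta k <= 1 /\ 2 * eta k < delta /\
                           hh (2 * eta k) <= a k / 3).
  { intros k; unfold eta.
    assert (Hp : 0 < Rpower (a k) (/ alpha)) by apply exp_pos.
    assert (Hp1 : Rpower (a k) (/ alpha) <= 1).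
    { replace 1 with (Rpower 1 (/ alpha))
        by (unfold Rpower; rewrite ln_1, Rmult_0_r; apply exp_0).
      apply Rle_Rpower_l; [apply Rlt_le, Rinv_0_lt_compat; lra|split; auto]. }
    assert (Hpos : 0 < kappa * Rpower (a k) (/ alpha))
      by (apply Rmult_lt_0_compat; lra).
    assert (Hle : kappa * Rpower (a k) (/ alpha) <= kappa) by nra.
    split; [lra|split; [lra|]].
    eapply Rle_trans; [apply Hgrow; lra|].
    unfold rpow; destruct (Rle_dec _ 0); [lra|].
    rewrite <- Rmult_assoc, <- Rpower_mult_distr by lra.
    rewrite Rpower_mult, Rinv_l, Rpower_1 by (auto; lra).
    pose proof (Ha k); nra. }
  assert (Hhr : forall k, 0 < h ((/ 2) ^ (k0 + k))).
  { intros k; pose proof (Hsmall k); destruct Hh as [_ [Hhpos _]].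
    assert (h ((/ 2) ^ (k0 + k)) <> 0) by (apply Hnz; lra).
    pose proof (Hhpos ((/ 2) ^ (k0 + k)) ltac:(lra)); lra. }
  set (G := Rpower S (2 + / alpha) / kappa).
  assert (HG : 0 <= G) by (apply Rlt_le, Rdiv_lt_0_compat; [apply exp_pos|lra]).
  assert (Hratio : forall k, ratio (k0 + k)%nat ^ 2 <= G * (a k ^ 2 * eta k)).
  { intros k; unfold G, eta.
    replace (_ / kappa * _) with
      (Rpower S (2 + / alpha) * (a k ^ 2 * Rpower (a k) (/ alpha))) by (field; lra).
    apply weight_bound; [lra| |apply Ha|assumption|].
    - pose proof (Hsmall k); destruct Hhh as [_ [Hhhpos _]].
      apply Rmult_le_pos; [|apply Rlt_le, Rinv_0_lt_compat, Hhr].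
      apply Rmult_le_pos; [apply Hhhpos; lra|apply sqrt_pos].
    - fold theta; unfold a.
      replace (S * _) with (rpow (ratio (k0 + k)%nat) theta + (/ 2) ^ k) by (field; lra).
      pose proof (pow_lt (/ 2) k ltac:(lra)); lra. }
  set (G1 := 360 * C ^ 2 * G).
  assert (HG1 : 0 <= G1)
    by (apply Rmult_le_pos; [pose proof (pow2_ge_0 C); lra|assumption]).
  (* As [mu <= 1], [G1 * mu^2 <= G1 * mu], which is below [cg]; the [+ 1] avoids dividing by [0]. *)
  set (mu := Rmin 1 (cg / (2 * (G1 + 1)))).
  assert (Hmu : 0 < mu).
  { apply Rmin_glb_lt; [lra|]; apply Rdiv_lt_0_compat; lra. }
  assert (Hmu1 : mu <= 1) by apply Rmin_l.
  assert (HGmu : G1 * mu ^ 2 < cg).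
  { apply Rle_lt_trans with (G1 * mu); [apply Rmult_le_compat_l; [assumption|nra]|].
    assert (H2 : mu * (2 * (G1 + 1)) <= cg).
    { apply Rle_trans with (cg / (2 * (G1 + 1)) * (2 * (G1 + 1))).
      - apply Rmult_le_compat_r; [lra|apply Rmin_r].
      - apply Req_le; field; lra. }
    nra. }
  exists (2 * (/ 2) ^ k0); split; [lra|].
  exists mu; split; [exact Hmu|].
  intros U d HU Hcov c' Hc'.
  (* If no partial sum exceeds [c'], all are at most [mu], and the estimate for this cover gives
     [cg <= G1 * mu^2 < cg]. *)
  apply NNPP; intros Hno.
  assert (Hbd : forall n, sumn (fun i => h (d i)) n <= mu).
  { intros n; apply Rnot_lt_le; intros Hlt; apply Hno; exists n.
    rewrite sum_f_R0_sumn; apply Rlt_le_trans with (sumn (fun i => h (d i)) n); [lra|].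
    apply sumn_mono; [|lia]; intros i; apply Hh, (diam_nonneg (U i)), HU. }
  pose proof (cover_sum_lower_bound gg hh h C delta deltag cg G E L k0 eta a U d mu
    Hgg Hhh Hh ltac:(lra) Hdbl HL Hcont
    (fun e He => match Hseg e He with ex_intro _ T (conj H1 H2) =>
       ex_intro _ T (conj H1 (H2 delta ltac:(unfold delta; lra))) end)
    ltac:(lra) ltac:(lra) Hhr Ha Hasum Heta HG Hratio HU Hcov Hbd) as Hfin.
  fold G1 in Hfin; lra.
Qed.
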